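(* Let ${\mathcal{A}}_{\zeta}\bowtie_{\psi}\mathcal{B}$ be a bicocycle double cross product $3$-Lie algebroid over a manifold $M$ with data $(\phi,\zeta,\psi,\theta,\rho,\sigma)$. Then it reduces to the following structures (as defined in the context) under the following vanishing conditions: (i) if $\psi=0$, it is a unified product $3$-Lie algebroid ${\mathcal{A}}_{\zeta}\bowtie\mathcal{B}$; if $\zeta=0$, it is a unified product $3$-Lie algebroid $\mathcal{A}\bowtie_{\psi}\mathcal{B}$; (ii) if $\zeta=0$ and $\psi=0$, it is a double cross product $3$-Lie algebroid $\mathcal{A}\bowtie\mathcal{B}$; (iii) if $\zeta=0$, $\psi=0$ and $\rho=0$, it is a semi-direct product $3$-Lie algebroid $\mathcal{A}\ltimes\mathcal{B}$; if $\zeta=0$, $\psi=0$ and $\sigma=0$, it is a semi-direct product $3$-Lie algebroid $\mathcal{A}\rtimes\mathcal{B}$; (iv) if one of the twisted cocycles $\zeta,\psi$ and one of the action terms $\rho,\sigma$ vanish, it is a cocycle extension; in particular, if $\zeta=0$ and $\rho=0$, it is the cocycle extension $\mathcal{A}\ltimes_{\psi}\mathcal{B}$; (v) if $\zeta=0$, $\psi=0$, $\rho=0$ and $\sigma=0$, it is the direct product $3$-Lie algebroid $\mathcal{A}\times\mathcal{B}$.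
   Context: $M$ is a smooth manifold; $\Gamma(E)$ denotes the smooth sections of a vector bundle $E\to M$. A $3$-anchored bundle $(\mathcal{A},\tau,M,\mathfrak{a}_{\mathcal{A}})$ is a vector bundle $\tau:\mathcal{A}\to M$ with an $\mathbb{R}$-bilinear skew-symmetric map $\mathfrak{a}_{\mathcal{A}}:\Gamma(\mathcal{A})\wedge\Gamma(\mathcal{A})\to\Gamma(TM)$. A $3$-Lie algebroid is a $3$-anchored bundle with an $\mathbb{R}$-trilinear skew-symmetric bracket $[\bullet,\bullet,\bullet]$ on $\Gamma(\mathcal{A})$ such that, for all sections and all $f\in C^\infty(M)$: (1) $\mathfrak{a}_{\mathcal{A}}([X_1,X_2,Y_1]\wedge Y_2)+\mathfrak{a}_{\mathcal{A}}(Y_1\wedge[X_1,X_2,Y_2])=[\mathfrak{a}_{\mathcal{A}}(X_1\wedge X_2),\mathfrak{a}_{\mathcal{A}}(Y_1\wedge Y_2)]$; (2) $[X_1,X_2,[Y_1,Y_2,Y_3]]=[[X_1,X_2,Y_1],Y_2,Y_3]+[Y_1,[X_1,X_2,Y_2],Y_3]+[Y_1,Y_2,[X_1,X_2,Y_3]]$; (3) $[X_1,X_2,fY]=f[X_1,X_2,Y]+\mathfrak{a}_{\mathcal{A}}(X_1\wedge X_2)(f)Y$. A $3$-Lie algebroid action of $\mathcal{A}$ on a vector bundle $E\to M$ is an $\mathbb{R}$-bilinear skew-symmetric map $\varrho:\Gamma(\mathcal{A})\wedge\Gamma(\mathcal{A})\to\operatorname{End}_{\mathbb{R}}(\Gamma(E))$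 with $\varrho(fX_1,X_2)(s)=f\varrho(X_1,X_2)(s)$, $\varrho(X_1,X_2)(fs)=f\varrho(X_1,X_2)(s)+\mathfrak{a}_{\mathcal{A}}(X_1\wedge X_2)(f)s$, $\varrho(X_1,X_2)\varrho(Y_1,Y_2)-\varrho(Y_1,Y_2)\varrho(X_1,X_2)=\varrho([X_1,X_2,Y_1],Y_2)+\varrho(Y_1,[X_1,X_2,Y_2])$, and $\varrho([Y_1,Y_2,Y_3],Y_4)=\varrho(Y_1,Y_2)\varrho(Y_3,Y_4)+\varrho(Y_2,Y_3)\varrho(Y_1,Y_4)+\varrho(Y_3,Y_1)\varrho(Y_2,Y_4)$. Bicocycle double cross product. Let $(\mathcal{A},\tau,M,\mathfrak{a}_{\mathcal{A}})$, $(\mathcal{B},\kappa,M,\mathfrak{a}_{\mathcal{B}})$ be $3$-anchored bundles over $M$, with $\mathbb{R}$-trilinear maps $\phi:\wedge^3\Gamma(\mathcal{A})\to\Gamma(\mathcal{A})$, $\zeta:\wedge^3\Gamma(\mathcal{A})\to\Gamma(\mathcal{B})$, $\psi:\wedge^3\Gamma(\mathcal{B})\to\Gamma(\mathcal{A})$, $\theta:\wedge^3\Gamma(\mathcal{B})\to\Gamma(\mathcal{B})$ (all skew-symmetric), $\rho:\Gamma(\mathcal{B})\wedge\Gamma(\mathcal{B})\otimes\Gamma(\mathcal{A})\to\Gamma(\mathcal{A})$, $\sigma:\Gamma(\mathcal{B})\otimes\Gamma(\mathcal{A})\wedge\Gamma(\mathcal{A})\to\Gamma(\mathcal{B})$.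 The maps $\zeta,\psi$ are called twisted cocycles and $\rho,\sigma$ action terms. On the Whitney sum $\mathcal{A}\times\mathcal{B}$ (sections written $(X,\eta)$) take the anchor $\mathfrak{a}_{\mathcal{A}\times\mathcal{B}}((X_1,\eta_1)\wedge(X_2,\eta_2))=\mathfrak{a}_{\mathcal{A}}(X_1\wedge X_2)+\mathfrak{a}_{\mathcal{B}}(\eta_1\wedge\eta_2)$ and the bracket $[(X_1,\eta_1),(X_2,\eta_2),(X_3,\eta_3)]=(\widetilde X,\widetilde\eta)$, $$\widetilde X=\phi(X_1,X_2,X_3)+\psi(\eta_1,\eta_2,\eta_3)+\rho(\eta_2,\eta_3,X_1)-\rho(\eta_1,\eta_3,X_2)+\rho(\eta_1,\eta_2,X_3),$$ $$\widetilde\eta=\theta(\eta_1,\eta_2,\eta_3)+\zeta(X_1,X_2,X_3)+\sigma(\eta_3,X_1,X_2)-\sigma(\eta_2,X_1,X_3)+\sigma(\eta_1,X_2,X_3).$$ If these make $\mathcal{A}\times\mathcal{B}$ a $3$-Lie algebroid, it is called the bicocycle double cross product $3$-Lie algebroid ${\mathcal{A}}_{\zeta}\bowtie_{\psi}\mathcal{B}$. Special structures (each is a $3$-Lie algebroid on $\mathcal{A}\times\mathcal{B}$ with anchor $\mathfrak{a}_{\mathcal{A}\times\mathcal{B}}$). ''$\mathcal{A}$ is a $3$-Lie subalgebroid'' means that $\Gamma(\mathcal{A})$ is closed under the bracket and $\mathcal{A}$ is a $3$-Lie algebroid with bracket $\phi$ and anchor $\mathfrak{a}_{\mathcal{A}}$;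 similarly for $\mathcal{B}$ with $\theta$ and $\mathfrak{a}_{\mathcal{B}}$. ''$\rho$ is a genuine action'' means that $(\eta_1,\eta_2)\mapsto\rho(\eta_1,\eta_2,\cdot)$ is a $3$-Lie algebroid action of $\mathcal{B}$ on the vector bundle $\mathcal{A}$; ''$\sigma$ is a genuine action'' means that $(X_1,X_2)\mapsto\sigma(\cdot,X_1,X_2)$ is a $3$-Lie algebroid action of $\mathcal{A}$ on the vector bundle $\mathcal{B}$. - Unified product ${\mathcal{A}}_{\zeta}\bowtie\mathcal{B}$: the bracket is $[(X_1,\eta_1),(X_2,\eta_2),(X_3,\eta_3)]=(\widetilde X,\widetilde\eta)$ with $\widetilde X=\phi(X_1,X_2,X_3)+\rho(\eta_2,\eta_3,X_1)-\rho(\eta_1,\eta_3,X_2)+\rho(\eta_1,\eta_2,X_3)$, $\widetilde\eta=\theta(\eta_1,\eta_2,\eta_3)+\zeta(X_1,X_2,X_3)+\sigma(\eta_3,X_1,X_2)-\sigma(\eta_2,X_1,X_3)+\sigma(\eta_1,X_2,X_3)$, $\mathcal{B}$ is a $3$-Lie subalgebroid, and $\rho$ is a genuine action. Unified product $\mathcal{A}\bowtie_{\psi}\mathcal{B}$: the bracket is $[(X_1,\eta_1),(X_2,\eta_2),(X_3,\eta_3)]=(\widetilde X,\widetilde\eta)$ with $\widetilde X=\phi(X_1,X_2,X_3)+\psi(\eta_1,\eta_2,\eta_3)+\rho(\eta_2,\eta_3,X_1)-\rho(\eta_1,\eta_3,X_2)+\rho(\eta_1,\eta_2,X_3)$, $\widetilde\eta=\theta(\eta_1,\eta_2,\eta_3)+\sigma(\eta_3,X_1,X_2)-\sigma(\eta_2,X_1,X_3)+\sigma(\eta_1,X_2,X_3)$,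 $\mathcal{A}$ is a $3$-Lie subalgebroid, and $\sigma$ is a genuine action. - Double cross product (matched pair) $\mathcal{A}\bowtie\mathcal{B}$: the bracket is $[(X_1,\eta_1),(X_2,\eta_2),(X_3,\eta_3)]=(\widetilde X,\widetilde\eta)$ with $\widetilde X=\phi(X_1,X_2,X_3)+\rho(\eta_2,\eta_3,X_1)-\rho(\eta_1,\eta_3,X_2)+\rho(\eta_1,\eta_2,X_3)$, $\widetilde\eta=\theta(\eta_1,\eta_2,\eta_3)+\sigma(\eta_3,X_1,X_2)-\sigma(\eta_2,X_1,X_3)+\sigma(\eta_1,X_2,X_3)$, both $\mathcal{A}$ and $\mathcal{B}$ are $3$-Lie subalgebroids, and both $\rho$ and $\sigma$ are genuine actions. - Semi-direct product $\mathcal{A}\ltimes\mathcal{B}$: a double cross product with bracket $\widetilde X=\phi(X_1,X_2,X_3)$, $\widetilde\eta=\theta(\eta_1,\eta_2,\eta_3)+\sigma(\eta_3,X_1,X_2)-\sigma(\eta_2,X_1,X_3)+\sigma(\eta_1,X_2,X_3)$. Semi-direct product $\mathcal{A}\rtimes\mathcal{B}$: a double cross product with bracket $\widetilde X=\phi(X_1,X_2,X_3)+\rho(\eta_2,\eta_3,X_1)-\rho(\eta_1,\eta_3,X_2)+\rho(\eta_1,\eta_2,X_3)$, $\widetilde\eta=\theta(\eta_1,\eta_2,\eta_3)$. - Cocycle extension: a unified product in which only one of the two action terms $\rho,\sigma$ is present, the other being absent from the bracket; $\mathcal{A}\ltimes_{\psi}\mathcal{B}$ is the unified product $\mathcal{A}\bowtie_{\psi}\mathcal{B}$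 with the $\rho$ terms absent. - Direct product $\mathcal{A}\times\mathcal{B}$: the bracket is $(\phi(X_1,X_2,X_3),\theta(\eta_1,\eta_2,\eta_3))$, with both $\mathcal{A}$ and $\mathcal{B}$ being $3$-Lie subalgebroids. *)

(* Defs.v *)
From HB Require Import structures.
From mathcomp Require Import all_boot all_order all_algebra.
From mathcomp Require Import all_classical all_reals all_analysis.
From mathcomp Require Import ring.

Set Implicit Arguments.
Unset Strict Implicit.
Unset Printing Implicit Defensive.

Import Order.TTheory GRing.Theory Num.Theory.
Import numFieldNormedType.Exports.

Local Open Scope classical_set_scope.
Local Open Scope ring_scope.

Section EuclideanSmoothness.
Context {R : realType} {n : nat}.
Implicit Types (U : set 'rV[R]_n) (f g h : 'rV[R]_n -> R) (s : seq 'I_n).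

Definition partial (i : 'I_n) g : 'rV[R]_n -> R := 'D_(delta_mx 0 i) g.

Definition partials s g : 'rV[R]_n -> R := foldr partial g s.

(* Meant for open [U]: all iterated partial derivatives exist and are
   continuous on [U]. *)
Definition smooth_in U g : Prop := forall s y, U y ->
  {for y, continuous (partials s g)} /\
  forall i, derivable (partials s g) y (delta_mx 0 i).

Let good s U g : Prop := forall y, U y ->
  {for y, continuous (partials s g)} /\
  forall i, derivable (partials s g) y (delta_mx 0 i).

Let upto k U g : Prop := forall s, (size s <= k)%N -> good s U g.

Lemma near_partials s f g (y : 'rV[R]_n) :
  (\forall z \near y, f z = g z) ->
  \forall z \near y, partials s f z = partials s g z.
Proof.
move=> fg; elim: s => //= i s ih.
have := near_join ih; apply: filterS => z fgz.
by rewrite /partial; apply: near_eq_derive.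
Qed.

Let near_good s U f g : open U -> (forall y, U y -> f y = g y) ->
  good s U f -> good s U g.
Proof.
move=> oU fg sf y Uy; have [cf df] := sf y Uy.
have e : \forall z \near y, partials s f z = partials s g z.
  apply: near_partials; have : nbhs y U by exact: open_nbhs_nbhs.
  by apply: filterS => z /fg.
split=> [|i]; last first.
  exact: near_eq_derivable e (df i).
rewrite /prop_for /continuous_at -(nbhs_singleton e).
apply: cvg_trans cf; exact: (near_eq_cvg e).
Qed.

Lemma smooth_in_eq U f g : open U -> (forall y, U y -> f y = g y) ->
  smooth_in U f -> smooth_in U g.
Proof. by move=> oU fg sf s; apply: (near_good oU fg); apply: sf. Qed.

Lemma smooth_in_sub U V g : V `<=` U -> smooth_in U g -> smooth_in V g.
Proof. by move=> VU sg s y /VU; apply: sg. Qed.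

Lemma smooth_in_local U g :
  (forall y, U y -> exists2 V, V y & smooth_in V g) -> smooth_in U g.
Proof. by move=> h s y /h[V Vy]; apply. Qed.

Lemma smooth_in_cst U (a : R) : smooth_in U (cst a).
Proof.
move=> s y _.
have [b ->] : exists b : R, partials s (cst a) = cst b.
  elim: s => [|i s [b /= ->]]; first by exists a.
  by exists 0; apply/funext => z; rewrite /partial derive_cst.
by split=> [|i]; [exact: cst_continuous|exact: derivable_cst].
Qed.

Let partialsS s i g : partials (rcons s i) g = partials s (partial i g).
Proof. by rewrite /partials foldr_rcons. Qed.

Let uptoS k U g : upto k.+1 U g ->
  good [::] U g /\ forall i, upto k U (partial i g).
Proof.
move=> h; split; first exact: h.
by move=> i s ks; rewrite /good -partialsS; apply: h; rewrite size_rcons.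
Qed.

Let uptoS' k U g : good [::] U g -> (forall i, upto k U (partial i g)) ->
  upto k.+1 U g.
Proof.
move=> g0 gk s; elim/last_ind: s => [//|s i _]; rewrite size_rcons ltnS => ks.
by rewrite /good partialsS; apply: gk.
Qed.

Let upto_eq k U f g : open U -> (forall y, U y -> f y = g y) ->
  upto k U f -> upto k U g.
Proof. by move=> oU fg h s /h; apply: near_good. Qed.

Let uptoW k U g : upto k.+1 U g -> upto k U g.
Proof. by move=> h s ks; apply: h; rewrite leqW. Qed.

Let goodD U f g : good [::] U f -> good [::] U g -> good [::] U (f + g).
Proof.
move=> gf gg y Uy; have [cf df] := gf y Uy; have [cg dg] := gg y Uy.
by split=> [|i]; [exact: continuousD|exact: derivableD].
Qed.

Let goodM U f g : good [::] U f -> good [::] U g -> good [::] U (f * g).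
Proof.
move=> gf gg y Uy; have [cf df] := gf y Uy; have [cg dg] := gg y Uy.
by split=> [|i]; [exact: continuousM|exact: derivableM].
Qed.

Let uptoD k U f g : open U -> upto k U f -> upto k U g -> upto k U (f + g).
Proof.
move=> oU; elim: k f g => [|k ih] f g hf hg.
  by move=> s; rewrite leqn0 size_eq0 => /eqP ->; apply: goodD; [apply: hf|apply: hg].
have [f0 fk] := uptoS hf; have [g0 gk] := uptoS hg.
apply: uptoS' => [|i]; first exact: goodD.
have e y : U y -> (partial i f + partial i g) y = partial i (f + g) y.
  by move=> Uy; rewrite /partial deriveD; [|exact: (f0 y Uy).2|exact: (g0 y Uy).2].
exact: upto_eq oU e (ih _ _ (fk i) (gk i)).
Qed.

Let uptoM k U f g : open U -> upto k U f -> upto k U g -> upto k U (f * g).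
Proof.
move=> oU; elim: k f g => [|k ih] f g hf hg.
  by move=> s; rewrite leqn0 size_eq0 => /eqP ->; apply: goodM; [apply: hf|apply: hg].
have [f0 fk] := uptoS hf; have [g0 gk] := uptoS hg.
apply: uptoS' => [|i]; first exact: goodM.
have e y : U y -> (f * partial i g + g * partial i f) y = partial i (f * g) y.
  by move=> Uy; rewrite /partial deriveM; [|exact: (f0 y Uy).2|exact: (g0 y Uy).2].
exact: upto_eq oU e (uptoD oU (ih _ _ (uptoW hf) (gk i)) (ih _ _ (uptoW hg) (fk i))).
Qed.

Lemma smooth_inD U f g : open U ->
  smooth_in U f -> smooth_in U g -> smooth_in U (f + g).
Proof.
by move=> oU sf sg s; apply: (@uptoD (size s)) => // t _; [apply: sf|apply: sg].
Qed.

Lemma smooth_inM U f g : open U ->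
  smooth_in U f -> smooth_in U g -> smooth_in U (f * g).
Proof.
by move=> oU sf sg s; apply: (@uptoM (size s)) => // t _; [apply: sf|apply: sg].
Qed.

End EuclideanSmoothness.

(* [cinv] is the inverse of the homeomorphism [cmap] from the open set [cdom]
   onto the open set [cmap @` cdom]; both are total functions whose values
   elsewhere are irrelevant. *)
Record chart (R : realType) (n : nat) (T : topologicalType) := Chart {
  cdom : set T;
  cmap : T -> 'rV[R]_n;
  cinv : 'rV[R]_n -> T;
  cdom_open : open cdom;
  ccod_open : open (cmap @` cdom);
  cmap_cont : forall x, cdom x -> {for x, continuous cmap};
  cinv_cont : forall y, (cmap @` cdom) y -> {for y, continuous cinv};
  cmapK : forall x, cdom x -> cinv (cmap x) = x
}.

Record manifold (R : realType) := Manifold {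
  mspace :> topologicalType;
  mdim : nat;
  atlas : set (chart R mdim mspace);
  mhausdorff : hausdorff_space mspace;
  mcountable : second_countable (T := mspace);
  atlas_cover : forall x, exists2 c, atlas c & cdom c x;
  atlas_smooth : forall c d, atlas c -> atlas d -> forall j : 'I_mdim,
    smooth_in (cmap c @` (cdom c `&` cdom d))
              (fun y => cmap d (cinv c y) 0 j)
}.

Section SmoothFunctions.
Context {R : realType} (M : manifold R).

(* Meant for open [U]. *)
Definition smooth_on (U : set M) (f : M -> R) : Prop :=
  forall c, atlas c ->
    smooth_in (cmap c @` (cdom c `&` U)) (f \o cinv c).

Lemma chart_image_open (c : chart R (mdim M) M) (U : set M) :
  open U -> open (cmap c @` (cdom c `&` U)).
Proof.
move=> oU; rewrite openE => _ [x [cx Ux] <-].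
have cy : (cmap c @` cdom c) (cmap c x) by exists x.
have n1 : nbhs (cmap c x) (cmap c @` cdom c).
  by apply: open_nbhs_nbhs; split => //; exact: ccod_open.
have n2 : nbhs (cmap c x) (cinv c @^-1` U).
  by apply: (cinv_cont cy); rewrite cmapK//; exact: open_nbhs_nbhs.
apply: filterS (filterI n1 n2) => _ [[z cz <-]]; rewrite /preimage /= cmapK// => Uz.
by exists z.
Qed.

Lemma smooth_on_eq U f g : open U -> (forall x, U x -> f x = g x) ->
  smooth_on U f -> smooth_on U g.
Proof.
move=> oU fg sf c ac; apply: smooth_in_eq (sf c ac).
  exact: chart_image_open.
by move=> _ [x [cx Ux] <-] /=; rewrite cmapK// fg.
Qed.

Lemma smooth_on_sub U V f : V `<=` U -> smooth_on U f -> smooth_on V f.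
Proof.
move=> VU sf c ac; apply: smooth_in_sub (sf c ac).
by move=> _ [x [cx /VU Ux] <-]; exists x.
Qed.

Lemma smooth_on_local U f :
  (forall x, U x -> exists2 V : set M, V x & smooth_on (U `&` V) f) ->
  smooth_on U f.
Proof.
move=> h c ac; apply: smooth_in_local => _ [x [cx Ux] <-].
have [V Vx sV] := h x Ux.
by exists (cmap c @` (cdom c `&` (U `&` V))); [exists x|exact: sV].
Qed.

Lemma smooth_on_cst U a : smooth_on U (fun=> a).
Proof. by move=> c ac; exact: smooth_in_cst. Qed.

Lemma smooth_onD U f g : open U -> smooth_on U f -> smooth_on U g ->
  smooth_on U (fun x => f x + g x).
Proof.
move=> oU sf sg c ac; apply: (smooth_inD _ (sf c ac) (sg c ac)).
exact: chart_image_open.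
Qed.

Lemma smooth_onM U f g : open U -> smooth_on U f -> smooth_on U g ->
  smooth_on U (fun x => f x * g x).
Proof.
move=> oU sf sg c ac; apply: (smooth_inM _ (sf c ac) (sg c ac)).
exact: chart_image_open.
Qed.

Record smooth_fun := SmoothFun {
  sfval :> M -> R;
  sfvalP : smooth_on setT sfval
}.

Lemma smooth_fun_eq (f g : smooth_fun) : (forall x, f x = g x) -> f = g.
Proof.
case: f g => [f sf] [g sg] /= /funext fg.
by case: _ / fg sg => sg; congr SmoothFun; exact: Prop_irrelevance.
Qed.

Let sM (f g : smooth_fun) : smooth_on setT (fun x => f x * g x).
Proof. by apply: smooth_onM; [exact: openT|exact: sfvalP|exact: sfvalP]. Qed.
Let sD (f g : smooth_fun) : smooth_on setT (fun x => f x + g x).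
Proof. by apply: smooth_onD; [exact: openT|exact: sfvalP|exact: sfvalP]. Qed.
Let sZ a (f : smooth_fun) : smooth_on setT (fun x => a * f x).
Proof. by apply: smooth_onM; [exact: openT|exact: smooth_on_cst|exact: sfvalP]. Qed.
Let sN (f : smooth_fun) : smooth_on setT (fun x => - f x).
Proof.
by apply: (smooth_on_eq openT _ (sZ (-1) f)) => x _; rewrite mulN1r.
Qed.

Definition sfun_cst (a : R) := SmoothFun (@smooth_on_cst setT a).
Definition sfun_add f g := SmoothFun (sD f g).
Definition sfun_mul f g := SmoothFun (sM f g).
Definition sfun_opp f := SmoothFun (sN f).
Definition sfun_scale a f := SmoothFun (sZ a f).

HB.instance Definition _ := gen_eqMixin smooth_fun.
HB.instance Definition _ := gen_choiceMixin smooth_fun.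

Let addA : associative sfun_add.
Proof. by move=> f g h; apply: smooth_fun_eq => x /=; rewrite addrA. Qed.
Let addC : commutative sfun_add.
Proof. by move=> f g; apply: smooth_fun_eq => x /=; rewrite addrC. Qed.
Let add0 : left_id (sfun_cst 0) sfun_add.
Proof. by move=> f; apply: smooth_fun_eq => x /=; rewrite add0r. Qed.
Let addN : left_inverse (sfun_cst 0) sfun_opp sfun_add.
Proof. by move=> f; apply: smooth_fun_eq => x /=; rewrite addNr. Qed.
HB.instance Definition _ := GRing.isZmodule.Build smooth_fun addA addC add0 addN.

Let mulA : associative sfun_mul.
Proof. by move=> f g h; apply: smooth_fun_eq => x /=; rewrite mulrA. Qed.
Let mulC : commutative sfun_mul.
Proof. by move=> f g; apply: smooth_fun_eq => x /=; rewrite mulrC. Qed.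
Let mul1 : left_id (sfun_cst 1) sfun_mul.
Proof. by move=> f; apply: smooth_fun_eq => x /=; rewrite mul1r. Qed.
Let mulD : left_distributive sfun_mul +%R.
Proof. by move=> f g h; apply: smooth_fun_eq => x /=; rewrite mulrDl. Qed.
HB.instance Definition _ :=
  GRing.Zmodule_isComPzRing.Build smooth_fun mulA mulC mul1 mulD.

Let scaleA a b f : sfun_scale a (sfun_scale b f) = sfun_scale (a * b) f.
Proof. by apply: smooth_fun_eq => x /=; rewrite mulrA. Qed.
Let scale1 : left_id 1 sfun_scale.
Proof. by move=> f; apply: smooth_fun_eq => x /=; rewrite mul1r. Qed.
Let scaleDr : right_distributive sfun_scale +%R.
Proof. by move=> a f g; apply: smooth_fun_eq => x /=; rewrite mulrDr. Qed.
Let scaleDl f : {morph sfun_scale^~ f : a b / a + b}.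
Proof. by move=> a b; apply: smooth_fun_eq => x /=; rewrite mulrDl. Qed.
HB.instance Definition _ :=
  GRing.Zmodule_isLmodule.Build R smooth_fun scaleA scale1 scaleDr scaleDl.

End SmoothFunctions.

Section VectorFields.
Context {R : realType} (M : manifold R).

(* Tangent vectors at [x], as point derivations of C^oo(M). *)
Definition is_tangent (x : M) (v : smooth_fun M -> R) : Prop :=
  (forall a f g, v (a *: f + g) = a * v f + v g) /\
  (forall f g, v (f * g) = f x * v g + v f * g x).

(* Smooth sections of TM: a choice of tangent vectors [X_x] such that [X f] is
   smooth for every smooth [f]. *)
Record vfield := VField {
  vval : M -> smooth_fun M -> R;
  vval_tangent : forall x, is_tangent x (vval x);
  vval_smooth : forall f, smooth_on setT (fun x => vval x f)
}.

Definition vapp (X : vfield) (f : smooth_fun M) : smooth_fun M :=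
  SmoothFun (vval_smooth X f).

Lemma vfield_eq (X Y : vfield) : (forall f, vapp X f = vapp Y f) -> X = Y.
Proof.
case: X Y => [X tX sX] [Y tY sY] XY.
have {}XY : X = Y.
  by apply/funext => x; apply/funext => f; have /(congr1 (@^~ x)) := congr1 (@sfval _ _) (XY f).
by case: _ / XY tY sY {tX sX} (tX) (sX) => *; congr VField; exact: Prop_irrelevance.
Qed.

(* A pointwise Leibniz operator on C^oo(M) is a vector field. *)
Definition vfield_of (d : smooth_fun M -> smooth_fun M)
    (lin : linear d) (leib : forall f g, d (f * g) = f * d g + d f * g) : vfield.
Proof.
refine (@VField (fun x f => d f x) _ (fun f => sfvalP (d f))).
by move=> x; split=> [a f g|f g]; rewrite ?lin ?leib.
Defined.

Lemma vapp_linear (X : vfield) : linear (vapp X).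
Proof.
by move=> a f g; apply: smooth_fun_eq => x /=; rewrite (vval_tangent X x).1.
Qed.

Lemma vappM (X : vfield) f g : vapp X (f * g) = f * vapp X g + vapp X f * g.
Proof. by apply: smooth_fun_eq => x /=; rewrite (vval_tangent X x).2. Qed.

Let vappB (X : vfield) f g : vapp X (f - g) = vapp X f - vapp X g.
Proof. by rewrite addrC -scaleN1r vapp_linear scaleN1r addrC. Qed.
Let vappD (X : vfield) f g : vapp X (f + g) = vapp X f + vapp X g.
Proof. by have := vapp_linear X 1 f g; rewrite !scale1r. Qed.

Let zeroL : linear (fun _ : smooth_fun M => 0 : smooth_fun M).
Proof. by move=> a f g; rewrite scaler0 addr0. Qed.
Let zeroM f g : 0 = f * 0 + 0 * g :> smooth_fun M.
Proof. by rewrite mulr0 mul0r addr0. Qed.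
Definition vf_zero := vfield_of zeroL zeroM.

Let addL (X Y : vfield) : linear (fun f => vapp X f + vapp Y f).
Proof. by move=> a f g; rewrite !vapp_linear scalerDr addrACA. Qed.
Let addM (X Y : vfield) f g : vapp X (f * g) + vapp Y (f * g) =
  f * (vapp X g + vapp Y g) + (vapp X f + vapp Y f) * g.
Proof. by rewrite !vappM mulrDr mulrDl addrACA. Qed.
Definition vf_add X Y := vfield_of (addL X Y) (addM X Y).

Let scaleL a (X : vfield) : linear (fun f => a *: vapp X f).
Proof. by move=> b f g; rewrite vapp_linear scalerDr !scalerA mulrC. Qed.
Let scaleM a (X : vfield) f g :
  a *: vapp X (f * g) = f * (a *: vapp X g) + (a *: vapp X f) * g.
Proof.
rewrite vappM scalerDr; congr (_ + _); apply: smooth_fun_eq => x /=.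
  by rewrite mulrCA.
by rewrite mulrA.
Qed.
Definition vf_scale a X := vfield_of (scaleL a X) (scaleM a X).

Let brL (X Y : vfield) : linear (fun f => vapp X (vapp Y f) - vapp Y (vapp X f)).
Proof. by move=> a f g; rewrite !vapp_linear scalerBr opprD addrACA. Qed.
Let brM (X Y : vfield) f g :
  vapp X (vapp Y (f * g)) - vapp Y (vapp X (f * g)) =
  f * (vapp X (vapp Y g) - vapp Y (vapp X g)) +
  (vapp X (vapp Y f) - vapp Y (vapp X f)) * g.
Proof.
rewrite !vappM !vappD !vappM; apply: smooth_fun_eq => x /=.
rewrite mulrBr mulrBl.
move: (vval X x (vapp Y g)) (vval Y x (vapp X g)) (vval X x (vapp Y f))
  (vval Y x (vapp X f)) (vval X x f) (vval Y x f) (vval X x g) (vval Y x g).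
by move=> *; ring.
Qed.
Definition vf_bracket X Y := vfield_of (brL X Y) (brM X Y).

HB.instance Definition _ := gen_eqMixin vfield.
HB.instance Definition _ := gen_choiceMixin vfield.

Let addA : associative vf_add.
Proof.
move=> X Y Z; apply: vfield_eq => f; apply: smooth_fun_eq => x /=.
by rewrite addrA.
Qed.
Let addC : commutative vf_add.
Proof.
move=> X Y; apply: vfield_eq => f; apply: smooth_fun_eq => x /=.
by rewrite addrC.
Qed.
Let add0 : left_id vf_zero vf_add.
Proof.
move=> X; apply: vfield_eq => f; apply: smooth_fun_eq => x /=.
by rewrite add0r.
Qed.
Let addN : left_inverse vf_zero (vf_scale (-1)) vf_add.
Proof.
move=> X; apply: vfield_eq => f; apply: smooth_fun_eq => x /=.
by rewrite mulN1r addNr.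
Qed.
HB.instance Definition _ := GRing.isZmodule.Build vfield addA addC add0 addN.

Let scaleA a b X : vf_scale a (vf_scale b X) = vf_scale (a * b) X.
Proof.
by apply: vfield_eq => f; apply: smooth_fun_eq => x /=; rewrite mulrA.
Qed.
Let scale1 : left_id 1 vf_scale.
Proof.
by move=> X; apply: vfield_eq => f; apply: smooth_fun_eq => x /=; rewrite mul1r.
Qed.
Let scaleDr : right_distributive vf_scale +%R.
Proof.
move=> a X Y; apply: vfield_eq => f; apply: smooth_fun_eq => x /=.
by rewrite mulrDr.
Qed.
Let scaleDl X : {morph vf_scale^~ X : a b / a + b}.
Proof.
move=> a b; apply: vfield_eq => f; apply: smooth_fun_eq => x /=.
by rewrite mulrDl.
Qed.
HB.instance Definition _ :=
  GRing.Zmodule_isLmodule.Build R vfield scaleA scale1 scaleDr scaleDl.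

End VectorFields.

(* [tinv x] is the inverse of the linear isomorphism [tmap x] for [x] in the
   open set [tdom]; values over other points are irrelevant. *)
Record triv (R : realType) (M : manifold R) (F : M -> lmodType R) := Triv {
  tdom : set M;
  trank : nat;
  tmap : forall x, F x -> 'rV[R]_trank;
  tinv : forall x, 'rV[R]_trank -> F x;
  tdom_open : open tdom;
  tmap_linear : forall x, tdom x -> linear (@tmap x);
  tmapK : forall x, tdom x -> cancel (@tmap x) (@tinv x);
  tinvK : forall x, tdom x -> cancel (@tinv x) (@tmap x)
}.

Arguments tmap {R M F} t {x} _.
Arguments tinv {R M F} t x _.

(* A vector bundle is given by its fibres and a family of local
   trivializations covering the base, with smooth transition matrices; this
   determines the topology and smooth structure of the total space. The rank
   is only required to be locally constant. *)
Record vbundle (R : realType) (M : manifold R) := VBundle {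
  fiber : M -> lmodType R;
  trivs : set (triv fiber);
  trivs_cover : forall x, exists2 t, trivs t & tdom t x;
  trivs_smooth : forall s t, trivs s -> trivs t ->
    forall (i : 'I_(trank s)) (j : 'I_(trank t)),
    smooth_on (tdom s `&` tdom t)
      (fun x => tmap t (tinv s x (delta_mx 0 i)) 0 j)
}.

Section Sections.
Context {R : realType} {M : manifold R} (E : vbundle M).

Definition smooth_section (s : forall x, fiber E x) : Prop :=
  forall t, trivs t -> forall j : 'I_(trank t),
    smooth_on (tdom t) (fun x => tmap t (s x) 0 j).

Record sections := Section_ {
  secval :> forall x, fiber E x;
  secvalP : smooth_section secval
}.

Lemma sections_eq (s t : sections) : (forall x, s x = t x) -> s = t.
Proof.
case: s t => [s ps] [t pt] /= st.
have {}st : s = t by apply: functional_extensionality_dep.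
by case: _ / st pt => pt; congr Section_; exact: Prop_irrelevance.
Qed.

Let tmapD (t : triv (fiber E)) x u v : tdom t x ->
  tmap t (u + v : fiber E x) = tmap t u + tmap t v.
Proof. by move=> /tmap_linear tl; have := tl 1 u v; rewrite !scale1r. Qed.
Let tmap0 (t : triv (fiber E)) x : tdom t x -> tmap t (0 : fiber E x) = 0.
Proof.
by move=> tx; apply: (addrI (tmap t (0 : fiber E x))); rewrite -tmapD// !addr0.
Qed.
Let tmapZ (t : triv (fiber E)) x a u : tdom t x ->
  tmap t (a *: u : fiber E x) = a *: tmap t u.
Proof.
move=> tx; have := tmap_linear tx a u 0.
by rewrite tmap0// !addr0.
Qed.

Let sec0P : smooth_section (fun=> 0).
Proof.
move=> t pt j; apply: (smooth_on_eq (tdom_open t) _ (smooth_on_cst 0)).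
by move=> x tx; rewrite tmap0// mxE.
Qed.
Let secDP (s t : sections) : smooth_section (fun x => s x + t x).
Proof.
move=> w pw j.
apply: (smooth_on_eq (tdom_open w) _
  (smooth_onD (tdom_open w) (secvalP s pw j) (secvalP t pw j))).
by move=> x wx; rewrite tmapD// mxE.
Qed.
Let secMP (f : smooth_fun M) (s : sections) : smooth_section (fun x => f x *: s x).
Proof.
move=> w pw j.
have sf : smooth_on (tdom w) f by apply: smooth_on_sub (sfvalP f).
apply: (smooth_on_eq (tdom_open w) _
  (smooth_onM (tdom_open w) sf (secvalP s pw j))).
by move=> x wx; rewrite tmapZ// mxE.
Qed.

Definition sec_zero := Section_ sec0P.
Definition sec_add s t := Section_ (secDP s t).
(* The C^oo(M)-module structure of the sections. *)
Definition fscale f s := Section_ (secMP f s).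
Definition sec_scale (a : R) s := fscale (sfun_cst M a) s.

HB.instance Definition _ := gen_eqMixin sections.
HB.instance Definition _ := gen_choiceMixin sections.

Let addA : associative sec_add.
Proof. by move=> X Y Z; apply: sections_eq => x /=; rewrite addrA. Qed.
Let addC : commutative sec_add.
Proof. by move=> X Y; apply: sections_eq => x /=; rewrite addrC. Qed.
Let add0 : left_id sec_zero sec_add.
Proof. by move=> X; apply: sections_eq => x /=; rewrite add0r. Qed.
Let addN : left_inverse sec_zero (sec_scale (-1)) sec_add.
Proof. by move=> X; apply: sections_eq => x /=; rewrite scaleN1r addNr. Qed.
HB.instance Definition _ := GRing.isZmodule.Build sections addA addC add0 addN.

Let scaleA a b X : sec_scale a (sec_scale b X) = sec_scale (a * b) X.
Proof. by apply: sections_eq => x /=; rewrite scalerA. Qed.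
Let scale1 : left_id 1 sec_scale.
Proof. by move=> X; apply: sections_eq => x /=; rewrite scale1r. Qed.
Let scaleDr : right_distributive sec_scale +%R.
Proof. by move=> a X Y; apply: sections_eq => x /=; rewrite scalerDr. Qed.
Let scaleDl X : {morph sec_scale^~ X : a b / a + b}.
Proof. by move=> a b; apply: sections_eq => x /=; rewrite scalerDl. Qed.
HB.instance Definition _ :=
  GRing.Zmodule_isLmodule.Build R sections scaleA scale1 scaleDr scaleDl.

End Sections.

Section Whitney.
Context {R : realType} {M : manifold R} (A B : vbundle M).

Definition wfiber (x : M) : lmodType R := (fiber A x * fiber B x)%type.

Section Wtriv.
Variables (s : triv (fiber A)) (t : triv (fiber B)).

Definition wmap x (u : wfiber x) : 'rV[R]_(trank s + trank t) :=
  row_mx (tmap s u.1) (tmap t u.2).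
Definition winv x (v : 'rV[R]_(trank s + trank t)) : wfiber x :=
  (tinv s x (lsubmx v), tinv t x (rsubmx v)).

Let wopen : open (tdom s `&` tdom t).
Proof. by apply: openI; exact: tdom_open. Qed.
Let wlinear x : (tdom s `&` tdom t) x -> linear (@wmap x).
Proof.
move=> [sx tx] a u v; rewrite /wmap /= !tmap_linear//.
by rewrite scale_row_mx add_row_mx.
Qed.
Let wmapK x : (tdom s `&` tdom t) x -> cancel (@wmap x) (@winv x).
Proof.
by move=> [sx tx] [u v]; rewrite /wmap /winv /= row_mxKl row_mxKr !tmapK.
Qed.
Let winvK x : (tdom s `&` tdom t) x -> cancel (@winv x) (@wmap x).
Proof. by move=> [sx tx] v; rewrite /wmap /= !tinvK// hsubmxK. Qed.

Definition wtriv : triv wfiber := Triv wopen wlinear wmapK winvK.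
End Wtriv.

Definition wtrivs : set (triv wfiber) :=
  [set w | exists s t, [/\ trivs s, trivs t & w = wtriv s t]].

Let wcover x : exists2 w, wtrivs w & tdom w x.
Proof.
have [s ps sx] := trivs_cover A x; have [t pt tx] := trivs_cover B x.
by exists (wtriv s t); [exists s, t|split].
Qed.

Let tinv0 (E : vbundle M) (t : triv (fiber E)) x :
  tdom t x -> tmap t (tinv t x 0) = 0.
Proof. by move=> tx; rewrite tinvK. Qed.

Let tmap0 (E : vbundle M) (t : triv (fiber E)) x :
  tdom t x -> tmap t (0 : fiber E x) = 0.
Proof.
move=> tx; have := tmap_linear tx 1 0 0; rewrite scale1r addr0 => h.
by apply: (addrI (tmap t (0 : fiber E x))); rewrite addr0 [RHS]h scale1r.
Qed.

Let tinvz (E : vbundle M) (t : triv (fiber E)) x : tdom t x -> tinv t x 0 = 0.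
Proof. by move=> tx; rewrite -(tmap0 tx) tmapK. Qed.

Let wsmooth w w' : wtrivs w -> wtrivs w' -> forall i j,
  smooth_on (tdom w `&` tdom w') (fun x => tmap w' (tinv w x (delta_mx 0 i)) 0 j).
Proof.
move=> [s [t [ps pt ->]]] [s' [t' [ps' pt' ->]]] /= i j.
have oU : open (tdom s `&` tdom t `&` (tdom s' `&` tdom t')).
  by do ![apply: openI]; exact: tdom_open.
case: (split_ordP i) => k ->; case: (split_ordP j) => l ->.
- have := trivs_smooth ps ps' k l => /(@smooth_on_sub _ _ _ (tdom s `&` tdom t `&` (tdom s' `&` tdom t'))) h.
  apply: smooth_on_eq oU _ (h _) => [x [[sx tx] [s'x t'x]]|x [[sx tx] [s'x t'x]]]; last by split.
  rewrite /wmap /winv /= row_mxEl; congr (tmap s' (tinv s x _) 0 l).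
  by apply/rowP => m; rewrite !mxE (inj_eq (@lshift_inj _ _)).
- apply: smooth_on_eq oU _ (smooth_on_cst 0) => x [[sx tx] [s'x t'x]].
  rewrite /wmap /winv /= row_mxEr (_ : rsubmx _ = 0) ?tinvz ?tmap0 ?mxE//.
  by apply/rowP => m; rewrite !mxE eq_rlshift andbF.
- apply: smooth_on_eq oU _ (smooth_on_cst 0) => x [[sx tx] [s'x t'x]].
  rewrite /wmap /winv /= row_mxEl (_ : lsubmx _ = 0) ?tinvz ?tmap0 ?mxE//.
  by apply/rowP => m; rewrite !mxE eq_lrshift andbF.
- have := trivs_smooth pt pt' k l => /(@smooth_on_sub _ _ _ (tdom s `&` tdom t `&` (tdom s' `&` tdom t'))) h.
  apply: smooth_on_eq oU _ (h _) => [x [[sx tx] [s'x t'x]]|x [[sx tx] [s'x t'x]]]; last by split.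
  rewrite /wmap /winv /= row_mxEr; congr (tmap t' (tinv t x _) 0 l).
  by apply/rowP => m; rewrite !mxE (inj_eq (@rshift_inj _ _)).
Qed.

Definition whitney : vbundle M := VBundle wcover wsmooth.

Let wfstP (u : sections whitney) : @smooth_section _ _ A (fun x => (u x).1).
Proof.
move=> s ps j; apply: smooth_on_local => x sx.
have [t pt tx] := trivs_cover B x; exists (tdom t) => //.
have pw : @trivs _ _ whitney (wtriv s t) by exists s, t.
have := secvalP u pw (lshift _ j).
apply: smooth_on_eq; first by apply: openI; exact: tdom_open.
by move=> y [sy ty] /=; rewrite /wmap row_mxEl.
Qed.
Let wsndP (u : sections whitney) : @smooth_section _ _ B (fun x => (u x).2).
Proof.
move=> t pt j; apply: smooth_on_local => x tx.
have [s ps sx] := trivs_cover A x; exists (tdom s) => //.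
have pw : @trivs _ _ whitney (wtriv s t) by exists s, t.
have := secvalP u pw (rshift _ j); rewrite /= setIC.
apply: smooth_on_eq; first by apply: openI; exact: tdom_open.
by move=> y [sy ty] /=; rewrite /wmap row_mxEr.
Qed.
Let wpairP (X : sections A) (eta : sections B) :
  @smooth_section _ _ whitney (fun x => (X x, eta x)).
Proof.
move=> w [s [t [ps pt ->]]] j /=.
have oU : open (tdom s `&` tdom t) by apply: openI; exact: tdom_open.
case: (split_ordP j) => k ->.
- have := smooth_on_sub (@subIsetl _ _ (tdom t)) (secvalP X ps k).
  by apply: smooth_on_eq => // x _; rewrite /wmap row_mxEl.
- have := smooth_on_sub (@subIsetr _ (tdom s) _) (secvalP eta pt k).
  by apply: smooth_on_eq => // x _; rewrite /wmap row_mxEr.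
Qed.

Definition wfst u : sections A := Section_ (wfstP u).
Definition wsnd u : sections B := Section_ (wsndP u).
Definition wpair X eta : sections whitney := Section_ (wpairP X eta).

Lemma wpairK u : wpair (wfst u) (wsnd u) = u.
Proof. by apply: sections_eq => x /=; case: (u x). Qed.
Lemma wfst_pair X eta : wfst (wpair X eta) = X.
Proof. exact: sections_eq. Qed.
Lemma wsnd_pair X eta : wsnd (wpair X eta) = eta.
Proof. exact: sections_eq. Qed.

End Whitney.

Section Multilinear.
Context {R : realType}.

Definition is_bilinear (U V W : lmodType R) (f : U -> V -> W) : Prop :=
  (forall v, linear (fun u => f u v)) /\ (forall u, linear (f u)).

Definition is_trilinear (U V W T : lmodType R) (f : U -> V -> W -> T) : Prop :=
  [/\ forall v w, linear (fun u => f u v w),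
      forall u w, linear (fun v => f u v w) &
      forall u v, linear (f u v)].

Definition skew2 (U W : lmodType R) (f : U -> U -> W) : Prop :=
  forall u v, f u v = - f v u.

Definition skew12 (U V W : lmodType R) (f : U -> U -> V -> W) : Prop :=
  forall u v w, f u v w = - f v u w.

Definition skew23 (U V W : lmodType R) (f : V -> U -> U -> W) : Prop :=
  forall u v w, f u v w = - f u w v.

Definition skew3 (U W : lmodType R) (f : U -> U -> U -> W) : Prop :=
  skew12 f /\ skew23 f.

Definition vanishes3 (U V W T : lmodType R) (f : U -> V -> W -> T) : Prop :=
  forall u v w, f u v w = 0.

End Multilinear.

(* The anchor is only required to be R-bilinear, not C^oo(M)-bilinear. *)
Record anchored (R : realType) (M : manifold R) := Anchored {
  abundle :> vbundle M;
  anchor : sections abundle -> sections abundle -> vfield M;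
  anchor_bilinear : is_bilinear anchor;
  anchor_skew : skew2 anchor
}.

Record lie3_algebroid (R : realType) (M : manifold R) (A : anchored M)
  (br : sections A -> sections A -> sections A -> sections A) : Prop :=
  Lie3Algebroid {
  br_trilinear : is_trilinear br;
  br_skew : skew3 br;
  br_anchor : forall X1 X2 Y1 Y2,
    anchor (br X1 X2 Y1) Y2 + anchor Y1 (br X1 X2 Y2) =
    vf_bracket (anchor X1 X2) (anchor Y1 Y2);
  br_fundamental : forall X1 X2 Y1 Y2 Y3,
    br X1 X2 (br Y1 Y2 Y3) =
    br (br X1 X2 Y1) Y2 Y3 + br Y1 (br X1 X2 Y2) Y3 + br Y1 Y2 (br X1 X2 Y3);
  br_leibniz : forall X1 X2 f Y,
    br X1 X2 (fscale f Y) =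
    fscale f (br X1 X2 Y) + fscale (vapp (anchor X1 X2) f) Y
}.

(* The action of a 3-Lie algebroid [A] with bracket [br] on [E]; linearity of
   [act] in its third argument says that [act X1 X2] lies in End_R. *)
Record lie3_action (R : realType) (M : manifold R) (A : anchored M)
  (br : sections A -> sections A -> sections A -> sections A) (E : vbundle M)
  (act : sections A -> sections A -> sections E -> sections E) : Prop :=
  Lie3Action {
  act_trilinear : is_trilinear act;
  act_skew : skew12 act;
  act_fscale : forall f X1 X2 s, act (fscale f X1) X2 s = fscale f (act X1 X2 s);
  act_leibniz : forall X1 X2 f s,
    act X1 X2 (fscale f s) =
    fscale f (act X1 X2 s) + fscale (vapp (anchor X1 X2) f) s;
  act_comm : forall X1 X2 Y1 Y2 s,
    act X1 X2 (act Y1 Y2 s) - act Y1 Y2 (act X1 X2 s) =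
    act (br X1 X2 Y1) Y2 s + act Y1 (br X1 X2 Y2) s;
  act_br : forall Y1 Y2 Y3 Y4 s,
    act (br Y1 Y2 Y3) Y4 s =
    act Y1 Y2 (act Y3 Y4 s) + act Y2 Y3 (act Y1 Y4 s) + act Y3 Y1 (act Y2 Y4 s)
}.

Section WhitneyAnchor.
Context {R : realType} {M : manifold R} (A B : anchored M).

Let whitney_anc (u v : sections (whitney A B)) : vfield M :=
  anchor (wfst u) (wfst v) + anchor (wsnd u) (wsnd v).

Let wfst_linear : linear (@wfst R M A B).
Proof. by move=> a u v; exact: sections_eq. Qed.
Let wsnd_linear : linear (@wsnd R M A B).
Proof. by move=> a u v; exact: sections_eq. Qed.

Let whitney_bilinear : is_bilinear whitney_anc.
Proof.
have [lA rA] := anchor_bilinear A; have [lB rB] := anchor_bilinear B.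
split=> w a u v; rewrite /whitney_anc wfst_linear wsnd_linear.
  by rewrite lA lB scalerDr addrACA.
by rewrite rA rB scalerDr addrACA.
Qed.
Let whitney_skew : skew2 whitney_anc.
Proof.
by move=> u v; rewrite /whitney_anc anchor_skew (anchor_skew (wsnd u)) opprD.
Qed.

Definition whitney_anchored : anchored M :=
  Anchored whitney_bilinear whitney_skew.

End WhitneyAnchor.

Record bicocycle_data (R : realType) (M : manifold R) (A B : anchored M) :=
  BicocycleData {
  phi : sections A -> sections A -> sections A -> sections A;
  zeta : sections A -> sections A -> sections A -> sections B;
  psi : sections B -> sections B -> sections B -> sections A;
  theta : sections B -> sections B -> sections B -> sections B;
  rho : sections B -> sections B -> sections A -> sections A;
  sigma : sections B -> sections A -> sections A -> sections B;
  phi_trilinear : is_trilinear phi;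
  phi_skew : skew3 phi;
  zeta_trilinear : is_trilinear zeta;
  zeta_skew : skew3 zeta;
  psi_trilinear : is_trilinear psi;
  psi_skew : skew3 psi;
  theta_trilinear : is_trilinear theta;
  theta_skew : skew3 theta;
  rho_trilinear : is_trilinear rho;
  rho_skew : skew12 rho;
  sigma_trilinear : is_trilinear sigma;
  sigma_skew : skew23 sigma
}.

Section Products.
Context {R : realType} {M : manifold R} {A B : anchored M}.
Variable D : bicocycle_data A B.

Local Notation GA := (sections A).
Local Notation GB := (sections B).
Local Notation GAB := (sections (whitney_anchored A B)).
Local Notation pair := (@wpair R M A B).

Definition rho_terms (X1 X2 X3 : GA) (e1 e2 e3 : GB) : GA :=
  rho D e2 e3 X1 - rho D e1 e3 X2 + rho D e1 e2 X3.

Definition sigma_terms (X1 X2 X3 : GA) (e1 e2 e3 : GB) : GB :=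
  sigma D e3 X1 X2 - sigma D e2 X1 X3 + sigma D e1 X2 X3.

Definition bicocycle_bracket (u1 u2 u3 : GAB) : GAB :=
  let X1 := wfst u1 in let X2 := wfst u2 in let X3 := wfst u3 in
  let e1 := wsnd u1 in let e2 := wsnd u2 in let e3 := wsnd u3 in
  pair (phi D X1 X2 X3 + psi D e1 e2 e3 + rho_terms X1 X2 X3 e1 e2 e3)
       (theta D e1 e2 e3 + zeta D X1 X2 X3 + sigma_terms X1 X2 X3 e1 e2 e3).

Definition bicocycle_double_cross_product : Prop :=
  lie3_algebroid bicocycle_bracket.

Variable br : GAB -> GAB -> GAB -> GAB.

Definition bracket_is (F : GA -> GA -> GA -> GB -> GB -> GB -> GA)
    (G : GA -> GA -> GA -> GB -> GB -> GB -> GB) : Prop :=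
  forall X1 X2 X3 e1 e2 e3,
    br (pair X1 e1) (pair X2 e2) (pair X3 e3) =
    pair (F X1 X2 X3 e1 e2 e3) (G X1 X2 X3 e1 e2 e3).

Definition subalgebroid_A : Prop :=
  (forall X1 X2 X3, br (pair X1 0) (pair X2 0) (pair X3 0) =
                    pair (phi D X1 X2 X3) 0) /\
  lie3_algebroid (phi D).

Definition subalgebroid_B : Prop :=
  (forall e1 e2 e3, br (pair 0 e1) (pair 0 e2) (pair 0 e3) =
                    pair 0 (theta D e1 e2 e3)) /\
  lie3_algebroid (theta D).

Definition rho_genuine_action : Prop :=
  lie3_action (theta D) (E := A) (rho D).

Definition sigma_genuine_action : Prop :=
  lie3_action (phi D) (E := B) (fun X1 X2 e => sigma D e X1 X2).

Definition unified_product_zeta : Prop :=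
  [/\ lie3_algebroid br,
      bracket_is
        (fun X1 X2 X3 e1 e2 e3 =>
           phi D X1 X2 X3 + rho_terms X1 X2 X3 e1 e2 e3)
        (fun X1 X2 X3 e1 e2 e3 =>
           theta D e1 e2 e3 + zeta D X1 X2 X3 + sigma_terms X1 X2 X3 e1 e2 e3),
      subalgebroid_B & rho_genuine_action].

Definition unified_product_psi : Prop :=
  [/\ lie3_algebroid br,
      bracket_is
        (fun X1 X2 X3 e1 e2 e3 =>
           phi D X1 X2 X3 + psi D e1 e2 e3 + rho_terms X1 X2 X3 e1 e2 e3)
        (fun X1 X2 X3 e1 e2 e3 =>
           theta D e1 e2 e3 + sigma_terms X1 X2 X3 e1 e2 e3),
      subalgebroid_A & sigma_genuine_action].

Definition double_cross_product : Prop :=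
  [/\ lie3_algebroid br,
      bracket_is
        (fun X1 X2 X3 e1 e2 e3 =>
           phi D X1 X2 X3 + rho_terms X1 X2 X3 e1 e2 e3)
        (fun X1 X2 X3 e1 e2 e3 =>
           theta D e1 e2 e3 + sigma_terms X1 X2 X3 e1 e2 e3),
      subalgebroid_A /\ subalgebroid_B &
      rho_genuine_action /\ sigma_genuine_action].

(* A \ltimes B: no rho terms. *)
Definition semidirect_product_sigma : Prop :=
  double_cross_product /\
  bracket_is
    (fun X1 X2 X3 e1 e2 e3 => phi D X1 X2 X3)
    (fun X1 X2 X3 e1 e2 e3 => theta D e1 e2 e3 + sigma_terms X1 X2 X3 e1 e2 e3).

(* A \rtimes B: no sigma terms. *)
Definition semidirect_product_rho : Prop :=
  double_cross_product /\
  bracket_is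
    (fun X1 X2 X3 e1 e2 e3 => phi D X1 X2 X3 + rho_terms X1 X2 X3 e1 e2 e3)
    (fun X1 X2 X3 e1 e2 e3 => theta D e1 e2 e3).

Definition cocycle_extension_zeta_sigma : Prop :=
  unified_product_zeta /\
  bracket_is
    (fun X1 X2 X3 e1 e2 e3 => phi D X1 X2 X3)
    (fun X1 X2 X3 e1 e2 e3 =>
       theta D e1 e2 e3 + zeta D X1 X2 X3 + sigma_terms X1 X2 X3 e1 e2 e3).

Definition cocycle_extension_zeta_rho : Prop :=
  unified_product_zeta /\
  bracket_is
    (fun X1 X2 X3 e1 e2 e3 => phi D X1 X2 X3 + rho_terms X1 X2 X3 e1 e2 e3)
    (fun X1 X2 X3 e1 e2 e3 => theta D e1 e2 e3 + zeta D X1 X2 X3).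

(* A \ltimes_psi B *)
Definition cocycle_extension_psi_sigma : Prop :=
  unified_product_psi /\
  bracket_is
    (fun X1 X2 X3 e1 e2 e3 => phi D X1 X2 X3 + psi D e1 e2 e3)
    (fun X1 X2 X3 e1 e2 e3 => theta D e1 e2 e3 + sigma_terms X1 X2 X3 e1 e2 e3).

Definition cocycle_extension_psi_rho : Prop :=
  unified_product_psi /\
  bracket_is
    (fun X1 X2 X3 e1 e2 e3 =>
       phi D X1 X2 X3 + psi D e1 e2 e3 + rho_terms X1 X2 X3 e1 e2 e3)
    (fun X1 X2 X3 e1 e2 e3 => theta D e1 e2 e3).

Definition cocycle_extension : Prop :=
  [\/ cocycle_extension_zeta_sigma, cocycle_extension_zeta_rho,
      cocycle_extension_psi_sigma | cocycle_extension_psi_rho].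

Definition direct_product : Prop :=
  [/\ lie3_algebroid br,
      bracket_is
        (fun X1 X2 X3 e1 e2 e3 => phi D X1 X2 X3)
        (fun X1 X2 X3 e1 e2 e3 => theta D e1 e2 e3),
      subalgebroid_A & subalgebroid_B].

End Products.

(* Main.v *)
Require Import Defs.
From HB Require Import structures.
From mathcomp Require Import all_boot all_order all_algebra.
From mathcomp Require Import all_classical all_reals all_analysis.

(** The vanishing of [psi] says exactly that the sections [(0, e)] are closed
    under the bracket of the double cross product; they then carry the bracket
    [theta]. Mixed brackets obey
    [[(0, e1), (0, e2), (X, 0)] = (rho e1 e2 X, 0)],
    so [Gamma(A)] is stable under the inner derivations coming from
    [Gamma(B)], and every axiom asked of [theta] and [rho] follows from one of
    the ambient 3-Lie algebroid on sections of the form [(0, e)] and [(X, 0)].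
    The vanishing of [zeta] gives the same for [phi] and [sigma] with the two
    summands exchanged.

    Both halves are instances of two statements about an arbitrary 3-Lie
    algebroid: [lie3_algebroid_sub] restricts the structure along an embedding
    of modules of sections closed under the bracket, and [lie3_action_sub]
    extracts an action from a second embedded module stable under the first.
    What makes the action tensorial in its algebroid arguments is that the
    ambient anchor of a section of [A] and a section of [B] is zero.

    The parts of the theorem then follow by combining the two halves and
    erasing from the bracket formula the terms assumed to vanish. *)

Set Implicit Arguments.
Unset Strict Implicit.
Unset Printing Implicit Defensive.

Import GRing.Theory.

Local Open Scope ring_scope.

(** * Multilinear and skew-symmetric maps *)

Section Multilinear.
Context {R : realType}.

Lemma linear_zero (U V : lmodType R) (f : U -> V) : linear f -> f 0 = 0.
Proof. by move=> lf; have := lf (-1) 0 0; rewrite !scaleN1r !addNr. Qed.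

Lemma linear_add (U V : lmodType R) (f : U -> V) :
  linear f -> forall u v, f (u + v) = f u + f v.
Proof. by move=> lf u v; have := lf 1 u v; rewrite !scale1r. Qed.

Lemma linear_opp (U V : lmodType R) (f : U -> V) :
  linear f -> forall u, f (- u) = - f u.
Proof.
by move=> lf u; have := lf (-1) u 0; rewrite (linear_zero lf) !addr0 !scaleN1r.
Qed.

Lemma bilinear0 (U V W : lmodType R) (f : U -> V -> W) : is_bilinear f ->
  (forall v, f 0 v = 0) * (forall u, f u 0 = 0).
Proof.
move=> [l1 l2]; split=> [v|u]; last exact: linear_zero.
exact: (linear_zero (l1 v)).
Qed.

Lemma trilinear0 (U V W T : lmodType R) (f : U -> V -> W -> T) :
  is_trilinear f ->
  (forall v w, f 0 v w = 0) * (forall u w, f u 0 w = 0) *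
  (forall u v, f u v 0 = 0).
Proof.
move=> [l1 l2 l3]; split; first split; move=> v w.
- exact: (linear_zero (l1 v w)).
- exact: (linear_zero (l2 v w)).
- exact: (linear_zero (l3 v w)).
Qed.

Lemma skew3_cycle (U W : lmodType R) (f : U -> U -> U -> W) : skew3 f ->
  forall u v w, f u v w = f v w u.
Proof. by move=> [s12 s23] u v w; rewrite s12 s23 opprK. Qed.

End Multilinear.

(** * Restricting a 3-Lie algebroid to embedded modules of sections *)

Section Restriction.
Context {R : realType} {M : manifold R}.

Lemma fscale0 (E : vbundle M) (s : sections E) : fscale 0 s = 0.
Proof. by apply: sections_eq => x /=; rewrite scale0r. Qed.

Lemma vapp0 (f : smooth_fun M) : vapp 0 f = 0.
Proof. exact: smooth_fun_eq. Qed.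

(** Linearity over the smooth functions is recorded besides linearity over the
    scalars because the Leibniz rule and tensoriality must be transported. *)
Record section_embedding (E W : vbundle M) (i : sections E -> sections W) :
  Prop := SectionEmbedding {
  emb_linear : linear i;
  emb_fscale : forall f s, i (fscale f s) = fscale f (i s);
  emb_inj : injective i
}.

Variables (W : anchored M)
  (br : sections W -> sections W -> sections W -> sections W).
Hypothesis brP : lie3_algebroid br.

Variables (C : anchored M)
  (cbr : sections C -> sections C -> sections C -> sections C)
  (i : sections C -> sections W).
Hypotheses (iP : section_embedding i)
  (i_anchor : forall x y, anchor (i x) (i y) = anchor x y)
  (i_br : forall x y z, br (i x) (i y) (i z) = i (cbr x y z)).

Let iD := linear_add (emb_linear iP).

(** Each axiom of [cbr] is the image of the same axiom of [br], and [i] is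
    injective. *)
Lemma lie3_algebroid_sub : lie3_algebroid cbr.
Proof.
have [l1 l2 l3] := br_trilinear brP; have [s12 s23] := br_skew brP.
have iN := linear_opp (emb_linear iP).
split.
- by split=> x y a u v; apply: (emb_inj iP);
    rewrite -i_br !(emb_linear iP) -!i_br ?l1 ?l2 ?l3.
- by split=> x y z; apply: (emb_inj iP); rewrite iN -!i_br // s23.
- by move=> x1 x2 y1 y2; rewrite -!i_anchor -!i_br (br_anchor brP).
- move=> x1 x2 y1 y2 y3; apply: (emb_inj iP).
  by rewrite !iD -!i_br (br_fundamental brP).
- move=> x1 x2 f y; apply: (emb_inj iP).
  rewrite iD !(emb_fscale iP) -!i_br (emb_fscale iP).
  by rewrite (br_leibniz brP) i_anchor.
Qed.

Variables (E : vbundle M)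
  (act : sections C -> sections C -> sections E -> sections E)
  (j : sections E -> sections W).
Hypotheses (jP : section_embedding j)
  (ij_anchor : forall x s, anchor (i x) (j s) = 0)
  (ij_br : forall x y s, br (i x) (i y) (j s) = j (act x y s)).

(** Both compatibility conditions between [act] and [cbr] are the fundamental
    identity of [br]: with the section of [E] inside the derived bracket it
    gives the commutator of two actions, and with the section of [E] in the
    deriving pair it gives the action of a bracket. *)
Lemma lie3_action_sub : lie3_action cbr act.
Proof.
have [l1 l2 l3] := br_trilinear brP; have [s12 s23] := br_skew brP.
have cyc := skew3_cycle (br_skew brP).
have jN := linear_opp (emb_linear jP); have jD := linear_add (emb_linear jP).
split.
- by split=> x y a u v; apply: (emb_inj jP);
    rewrite (emb_linear jP) -!ij_br ?(emb_linear iP) ?(emb_linear jP)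
      ?l1 ?l2 ?l3.
- by move=> x y s; apply: (emb_inj jP); rewrite jN -!ij_br s12.
- (* Moved to the last slot, [f] is differentiated along the anchor of the
     other two arguments, one from each module, which is zero. *)
  move=> f x y s; apply: (emb_inj jP).
  rewrite (emb_fscale jP) -!ij_br (emb_fscale iP).
  rewrite [LHS]cyc (cyc (i x) (i y)).
  by rewrite (br_leibniz brP) ij_anchor vapp0 fscale0 addr0.
- move=> x y f s; apply: (emb_inj jP).
  rewrite jD !(emb_fscale jP) -!ij_br (emb_fscale jP).
  by rewrite (br_leibniz brP) i_anchor.
- move=> x1 x2 y1 y2 s; apply/eqP; rewrite subr_eq; apply/eqP.
  by apply: (emb_inj jP); rewrite !jD -!ij_br -!i_br (br_fundamental brP).
- (* The cyclic shift makes [br (i y4) (j s)] the inner derivation to which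
     the fundamental identity applies. *)
  move=> y1 y2 y3 y4 s; apply: (emb_inj jP).
  rewrite !jD -!ij_br -i_br [LHS]cyc (br_fundamental brP).
  rewrite -!(cyc _ (i y4) (j s)).
  by rewrite addrC addrA (cyc _ (i y2) (i y3)) -(cyc (i y3) (i y1)).
Qed.

End Restriction.

(** * The two summands of the Whitney sum *)

Section Summands.
Context {R : realType} {M : manifold R} (A B : anchored M).

Definition inA (X : sections A) : sections (whitney_anchored A B) :=
  wpair X (0 : sections B).

Definition inB (e : sections B) : sections (whitney_anchored A B) :=
  wpair (0 : sections A) e.

Lemma inA_embedding : section_embedding inA.
Proof.
split.
- by move=> a X Y; apply: sections_eq => x; congr pair => /=;
    rewrite scaler0 addr0.
- by move=> f X; apply: sections_eq => x; congr pair => /=; rewrite scaler0.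
- by move=> X Y /(congr1 (@wfst R M A B)); rewrite !wfst_pair.
Qed.

Lemma inB_embedding : section_embedding inB.
Proof.
split.
- by move=> a X Y; apply: sections_eq => x; congr pair => /=;
    rewrite scaler0 addr0.
- by move=> f X; apply: sections_eq => x; congr pair => /=; rewrite scaler0.
- by move=> X Y /(congr1 (@wsnd R M A B)); rewrite !wsnd_pair.
Qed.

Lemma anchor_inA X Y : anchor (inA X) (inA Y) = anchor X Y.
Proof.
by rewrite /= !wfst_pair !wsnd_pair (bilinear0 (anchor_bilinear B)) addr0.
Qed.

Lemma anchor_inB d e : anchor (inB d) (inB e) = anchor d e.
Proof.
by rewrite /= !wfst_pair !wsnd_pair (bilinear0 (anchor_bilinear A)) add0r.
Qed.

Lemma anchor_inAB X e : anchor (inA X) (inB e) = 0.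
Proof.
rewrite /= !wfst_pair !wsnd_pair.
rewrite (bilinear0 (anchor_bilinear A)) (bilinear0 (anchor_bilinear B)).
by rewrite addr0.
Qed.

Lemma anchor_inBA e X : anchor (inB e) (inA X) = 0.
Proof. by rewrite anchor_skew anchor_inAB oppr0. Qed.

End Summands.

(** * The bracket on triples from the two summands *)

Section Bracket.
Context {R : realType} {M : manifold R} {A B : anchored M}.
Variable D : bicocycle_data A B.
Local Notation br := (bicocycle_bracket D).

Lemma bicocycle_bracketE :
  bracket_is br
    (fun X1 X2 X3 e1 e2 e3 =>
       phi D X1 X2 X3 + psi D e1 e2 e3 + rho_terms D X1 X2 X3 e1 e2 e3)
    (fun X1 X2 X3 e1 e2 e3 =>
       theta D e1 e2 e3 + zeta D X1 X2 X3 + sigma_terms D X1 X2 X3 e1 e2 e3).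
Proof.
by move=> X1 X2 X3 e1 e2 e3; rewrite /bicocycle_bracket !wfst_pair !wsnd_pair.
Qed.

Let data0 := (trilinear0 (phi_trilinear D), trilinear0 (psi_trilinear D),
  trilinear0 (theta_trilinear D), trilinear0 (zeta_trilinear D),
  trilinear0 (rho_trilinear D), trilinear0 (sigma_trilinear D)).

(** Every term of the bracket formula with an argument in a slot fed by the
    other summand is evaluated at zero, so a triple inside one summand keeps
    only a bracket and a cocycle. *)
Lemma bracket_AAA X1 X2 X3 :
  br (inA _ X1) (inA _ X2) (inA _ X3) =
  wpair (phi D X1 X2 X3) (zeta D X1 X2 X3).
Proof.
rewrite bicocycle_bracketE /rho_terms /sigma_terms !data0.
by rewrite !(subr0, addr0, add0r).
Qed.

Lemma bracket_BBB e1 e2 e3 :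
  br (inB _ e1) (inB _ e2) (inB _ e3) =
  wpair (psi D e1 e2 e3) (theta D e1 e2 e3).
Proof.
rewrite bicocycle_bracketE /rho_terms /sigma_terms !data0.
by rewrite !(subr0, addr0, add0r).
Qed.

(** On a mixed triple only an action term survives, since the cocycles and the
    two brackets take all their arguments from one summand. *)
Lemma bracket_AAB X1 X2 e :
  br (inA _ X1) (inA _ X2) (inB _ e) = inB _ (sigma D e X1 X2).
Proof.
rewrite bicocycle_bracketE /rho_terms /sigma_terms !data0.
by rewrite !(subr0, addr0, add0r).
Qed.

Lemma bracket_BBA e1 e2 X :
  br (inB _ e1) (inB _ e2) (inA _ X) = inA _ (rho D e1 e2 X).
Proof.
rewrite bicocycle_bracketE /rho_terms /sigma_terms !data0.
by rewrite !(subr0, addr0, add0r).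
Qed.

Hypothesis brP : bicocycle_double_cross_product D.

(** * Vanishing twisted cocycles *)

Section PsiVanishes.
Hypothesis psi0 : vanishes3 (psi D).

Let br_theta e1 e2 e3 :
  br (inB _ e1) (inB _ e2) (inB _ e3) = inB _ (theta D e1 e2 e3).
Proof. by rewrite bracket_BBB psi0. Qed.

Lemma theta_subalgebroid : subalgebroid_B D br.
Proof.
split; first exact: br_theta.
exact: (lie3_algebroid_sub brP (inB_embedding A B)
  (@anchor_inB _ _ A B) br_theta).
Qed.

Lemma rho_action : rho_genuine_action D.
Proof.
exact: (lie3_action_sub brP (inB_embedding A B) (@anchor_inB _ _ A B) br_theta
  (inA_embedding A B) (@anchor_inBA _ _ A B) bracket_BBA).
Qed.

Lemma unified_product_of_psi0 : unified_product_zeta D br.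
Proof.
split; [exact: brP| |exact: theta_subalgebroid|exact: rho_action].
by move=> *; rewrite bicocycle_bracketE psi0 addr0.
Qed.

End PsiVanishes.

Section ZetaVanishes.
Hypothesis zeta0 : vanishes3 (zeta D).

Let br_phi X1 X2 X3 :
  br (inA _ X1) (inA _ X2) (inA _ X3) = inA _ (phi D X1 X2 X3).
Proof. by rewrite bracket_AAA zeta0. Qed.

Lemma phi_subalgebroid : subalgebroid_A D br.
Proof.
split; first exact: br_phi.
exact: (lie3_algebroid_sub brP (inA_embedding A B)
  (@anchor_inA _ _ A B) br_phi).
Qed.

Lemma sigma_action : sigma_genuine_action D.
Proof.
exact: (lie3_action_sub brP (inA_embedding A B) (@anchor_inA _ _ A B) br_phi
  (inB_embedding A B) (@anchor_inAB _ _ A B) bracket_AAB).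
Qed.

Lemma unified_product_of_zeta0 : unified_product_psi D br.
Proof.
split; [exact: brP| |exact: phi_subalgebroid|exact: sigma_action].
by move=> *; rewrite bicocycle_bracketE zeta0 addr0.
Qed.

End ZetaVanishes.

Lemma double_cross_product_of_cocycles0 :
  vanishes3 (zeta D) -> vanishes3 (psi D) -> double_cross_product D br.
Proof.
move=> zeta0 psi0; split; first exact: brP.
- by move=> *; rewrite bicocycle_bracketE zeta0 psi0 !addr0.
- by split; [exact: phi_subalgebroid|exact: theta_subalgebroid].
- by split; [exact: rho_action|exact: sigma_action].
Qed.

(** * Vanishing action terms *)

Lemma rho_terms0 : vanishes3 (rho D) ->
  forall X1 X2 X3 e1 e2 e3, rho_terms D X1 X2 X3 e1 e2 e3 = 0.
Proof. by move=> rho0 *; rewrite /rho_terms !rho0 subr0 addr0. Qed.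

Lemma sigma_terms0 : vanishes3 (sigma D) ->
  forall X1 X2 X3 e1 e2 e3, sigma_terms D X1 X2 X3 e1 e2 e3 = 0.
Proof. by move=> sigma0 *; rewrite /sigma_terms !sigma0 subr0 addr0. Qed.

Lemma cocycle_extension_of_zeta_rho0 :
  vanishes3 (zeta D) -> vanishes3 (rho D) -> cocycle_extension_psi_sigma D br.
Proof.
move=> zeta0 rho0; split; first exact: unified_product_of_zeta0.
by move=> *; rewrite bicocycle_bracketE zeta0 rho_terms0 // !addr0.
Qed.

Lemma cocycle_extension_of_vanishing :
  vanishes3 (zeta D) \/ vanishes3 (psi D) ->
  vanishes3 (rho D) \/ vanishes3 (sigma D) -> cocycle_extension D br.
Proof.
move=> [zeta0|psi0] [rho0|sigma0].
- by apply: Or43; exact: cocycle_extension_of_zeta_rho0.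
- apply: Or44; split; first exact: unified_product_of_zeta0.
  by move=> *; rewrite bicocycle_bracketE zeta0 sigma_terms0 // !addr0.
- apply: Or41; split; first exact: unified_product_of_psi0.
  by move=> *; rewrite bicocycle_bracketE psi0 rho_terms0 // !addr0.
- apply: Or42; split; first exact: unified_product_of_psi0.
  by move=> *; rewrite bicocycle_bracketE psi0 sigma_terms0 // !addr0.
Qed.

End Bracket.

(** * The reductions *)

Theorem lemma4p1 (R : realType) (M : manifold R) (A B : anchored M)
    (D : bicocycle_data A B) :
  bicocycle_double_cross_product D ->
  let br := bicocycle_bracket D in
  ((vanishes3 (psi D) -> unified_product_zeta D br) /\
   (vanishes3 (zeta D) -> unified_product_psi D br)) /\
  (vanishes3 (zeta D) -> vanishes3 (psi D) -> double_cross_product D br) /\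
  ((vanishes3 (zeta D) -> vanishes3 (psi D) -> vanishes3 (rho D) ->
      semidirect_product_sigma D br) /\
   (vanishes3 (zeta D) -> vanishes3 (psi D) -> vanishes3 (sigma D) ->
      semidirect_product_rho D br)) /\
  ((vanishes3 (zeta D) \/ vanishes3 (psi D) ->
    vanishes3 (rho D) \/ vanishes3 (sigma D) -> cocycle_extension D br) /\
   (vanishes3 (zeta D) -> vanishes3 (rho D) ->
      cocycle_extension_psi_sigma D br)) /\
  (vanishes3 (zeta D) -> vanishes3 (psi D) -> vanishes3 (rho D) ->
   vanishes3 (sigma D) -> direct_product D br).
Proof.
move=> brP br; rewrite {}/br; split.
  by split; [exact: unified_product_of_psi0|exact: unified_product_of_zeta0].
split; first exact: double_cross_product_of_cocycles0.
split.
  split=> zeta0 psi0 act0; split; try exact: double_cross_product_of_cocycles0.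
  - by move=> *; rewrite bicocycle_bracketE zeta0 psi0 rho_terms0 // !addr0.
  - by move=> *; rewrite bicocycle_bracketE zeta0 psi0 sigma_terms0 // !addr0.
split.
  split; first exact: cocycle_extension_of_vanishing.
  exact: cocycle_extension_of_zeta_rho0.
move=> zeta0 psi0 rho0 sigma0.
split; [exact: brP| |exact: phi_subalgebroid|exact: theta_subalgebroid].
move=> *; rewrite bicocycle_bracketE zeta0 psi0.
by rewrite rho_terms0 // sigma_terms0 // !addr0.
Qed.
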